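(* Fix $\beta\in(0,1/2)$ and $\alpha\in(0,1)$. For $x\ge 2$ let \[ \mathcal{V}^c(x)=\Big\{m\in\mathbb{N},\ m\le x:\ \gcd\Big(m,\prod_{p\le \exp((\log x)^\beta)}p\Big)=1\Big\},\qquad c_x=\prod_{p\le\exp((\log x)^\beta)}\Big(1-\frac1p\Big), \] products over primes $p$. Let $(P_i)_{i\ge0}$ be the $\alpha$-random walk on $\mathbb{Z}_{\ge0}$: $P_0=0$, $P_i=P_{i-1}+W_i$ with $W_1,W_2,\dots$ independent Bernoulli random variables, $\mathbb{P}(W_i=1)=\alpha$, $\mathbb{P}(W_i=0)=1-\alpha$. For $n\ge1$ let \[ \overline{S}_n=\frac1n\sum_{i=1}^n \mathbf{1}[P_i\in \mathcal{V}^c(n)]. \] Then almost surely $\overline{S}_n=c_n(1+o(1))$ as $n\to\infty$.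
   Context: $\mathbb{N}$ denotes the positive integers; $\mathbf{1}[\cdot]$ is the indicator of an event. *)

(* Defs.v *)
From HB Require Import structures.
From mathcomp Require Import all_boot all_order all_algebra.
From mathcomp Require Import finmap.
From mathcomp Require Import all_classical all_reals all_analysis.

Set Implicit Arguments.
Unset Strict Implicit.
Unset Printing Implicit Defensive.

Import Order.TTheory GRing.Theory Num.Theory.
Import numFieldNormedType.Exports.

Local Open Scope classical_set_scope.
Local Open Scope ring_scope.

Definition mutually_independent d d' (T : measurableType d)
    (T' : measurableType d') (R : realType) (P : probability T R)
    (I : choiceType) (X : I -> {RV P >-> T'}) : Prop :=
  forall (J : {fset I}) (A : I -> set T'),
    (forall i, measurable (A i)) ->
    (P (\bigcap_(i in [set` J]) (X i @^-1` A i)) =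
      \prod_(i <- J) P (X i @^-1` A i))%E.

Definition sieve_level (R : realType) (beta x : R) : R := expR (ln x `^ beta).

(* In the two products below the level y is positive, so for a natural number
   p the bound p < (Num.truncn y).+1 is equivalent to p%:R <= y. *)
Definition sieve_primorial (R : realType) (beta x : R) : nat :=
  (\prod_(p < (Num.truncn (sieve_level beta x)).+1 | prime p) p)%N.

Definition sieve_density (R : realType) (beta x : R) : R :=
  \prod_(p < (Num.truncn (sieve_level beta x)).+1 | prime p) (1 - p%:R^-1).

Definition sifted (R : realType) (beta x : R) : set nat :=
  [set m | [/\ (0 < m)%N, m%:R <= x & gcdn m (sieve_primorial beta x) = 1%N]].

(* The steps W_1, W_2, ... are indexed from 0: W i is the step from time i
   to time i.+1. *)
Fixpoint walk (T : Type) (W : nat -> T -> nat) (i : nat) (w : T) : nat :=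
  if i is j.+1 then (walk W j w + W j w)%N else 0%N.

Definition visit_average (R : realType) (T : Type) (beta : R)
    (W : nat -> T -> nat) (n : nat) (w : T) : R :=
  n%:R^-1 * \sum_(1 <= i < n.+1) \1_(sifted beta n%:R) (walk W i w).

(* Main.v *)
(** For every set [A] and every 0/1 path, a step of the walk from [m] to [m + 1]
    collects [1_A(m)] exactly once, so that
      [alpha * sum_(i < n) 1_A(P_i)
         = #|A inter [0, P_n)| + sum_(i < n) (alpha - W_i) * 1_A(P_i)].
    The last sum is a martingale with bounded steps; by Chernoff's bound and
    Borel-Cantelli it is almost surely [O(sqrt n * log n)], both for the sifted
    set [A] (which may depend on [n]) and for [A] = everything, where it says
    that [P_n] is close to [alpha * n]. It remains to count sifted integers up
    to [N = P_n]. With [y = exp ((log n) ^ beta)] and [s = 1 / (2 log y)],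
    Rankin's trick in Legendre's sieve gives the error
    [N ^ (1 - s) * prod_(p <= y) (1 + p ^ (s - 1)) <= n ^ (1 - s) * y ^ 2],
    while [c_n >= 1 / y] trivially. The relative error is then at most
    [exp (3 (log n) ^ beta - (log n) ^ (1 - beta) / 2)] up to a constant, and it
    tends to 0 precisely because [beta < 1 / 2]. *)

Require Import Defs.
From mathcomp Require Import all_boot all_order all_algebra.
From mathcomp Require Import finmap.
From mathcomp Require Import all_classical all_reals all_analysis.
From mathcomp Require Import ring lra zify.

Import Order.TTheory GRing.Theory Num.Theory.
Import numFieldNormedType.Exports.

Local Open Scope classical_set_scope.
Local Open Scope ring_scope.

(** * Legendre's recursion for integers free of given primes *)

Definition unsieved (s : seq nat) (m : nat) : bool :=
  all (fun p => ~~ (p %| m)%N) s.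

Definition unsieved_count (s : seq nat) (N : nat) : nat :=
  (\sum_(1 <= m < N.+1) unsieved s m)%N.

Lemma unsieved_countS (s : seq nat) (N : nat) :
  unsieved_count s N.+1 = (unsieved_count s N + unsieved s N.+1)%N.
Proof. by rewrite /unsieved_count big_nat_recr. Qed.

Lemma unsieved_mull (s : seq nat) (p m : nat) :
  prime p -> all prime s -> p \notin s -> unsieved s (p * m) = unsieved s m.
Proof.
move=> pp; elim: s => //= q s IHs /andP[pq ps].
rewrite inE negb_or => /andP[pDq psn].
by rewrite IHs // Euclid_dvdM // (dvdn_prime2 pq pp) eq_sym (negbTE pDq).
Qed.

(** The integers lost when [p] joins the sieve are the [p * k] with [k <= N %/ p], and since [p] is
    not in [s], [p * k] survives [s] exactly when [k] does. *)
Lemma unsieved_count_cons (s : seq nat) (p N : nat) :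
  prime p -> all prime s -> p \notin s ->
  (unsieved_count (p :: s) N + unsieved_count s (N %/ p))%N
    = unsieved_count s N.
Proof.
move=> pp ps psn; elim: N => [|N IHN].
  by rewrite div0n /unsieved_count !big_geq.
rewrite !unsieved_countS -IHN divnS ?prime_gt0 //=.
have [pN|_] := boolP (p %| N.+1)%N; last by rewrite add0n; lia.
have <- : unsieved s (N %/ p).+1 = unsieved s N.+1.
  by rewrite -(unsieved_mull s p) // -[in RHS](divnK pN) mulnC divnS ?prime_gt0 // pN.
by rewrite unsieved_countS; lia.
Qed.

(** * Rankin's error bound and elementary bounds on products over primes *)

Section Rankin.
Context {R : realType}.
Implicit Types (x th : R) (s : seq nat).

(* Legendre's recursion is linear, so the errors of the two branches add up;
   at each leaf the rounding error is at most [min 1 x <= x `^ th], which is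
   what keeps the sum over all divisors under control. *)
Lemma rankin_sieve th s (N : nat) x :
  0 <= th <= 1 -> uniq s -> all prime s -> N%:R <= x < N.+1%:R ->
  `|(unsieved_count s N)%:R - x * \prod_(p <- s) (1 - p%:R^-1)|
    <= x `^ th * \prod_(p <- s) (1 + (p%:R^-1) `^ th).
Proof.
move=> /andP[th0 th1]; elim: s N x => [|p s IHs] N x.
  move=> _ _ /andP[Nx xN]; rewrite !big_nil !mulr1 /unsieved_count.
  rewrite (_ : (\sum_(1 <= m < N.+1) _)%N = N); last first.
    by rewrite sum_nat_const_nat subn1 muln1.
  have x0 : 0 <= x by apply: le_trans Nx.
  have [N0|N0] := posnP N.
    rewrite N0 sub0r normrN ger0_norm //.
    have x1 : x <= 1 by rewrite N0 in xN; exact: ltW.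
    have [->|xn0] := eqVneq x 0; first exact: powR_ge0.
    by rewrite ger1_powR // lt_neqAle eq_sym xn0 x0.
  have x1 : 1 <= x by apply: le_trans Nx; rewrite ler1n.
  apply: (@le_trans _ _ 1).
    rewrite distrC ger0_norm ?subr_ge0 // lerBlDl natr1; exact: ltW.
  by rewrite -[leLHS](powRr0 x) ler_powR.
move=> /=/andP[psn us] /andP[pp ps] /andP[Nx xN].
have p0 : 0 < p%:R :> R by rewrite ltr0n prime_gt0.
have x0 : 0 <= x by apply: le_trans Nx.
have := IHs N x us ps; rewrite Nx xN => /(_ isT) H1.
(* The main term carries the real [x / p], whose floor is [N %/ p], so nothing is rounded before a
   leaf is reached. *)
have Np : (N %/ p)%:R <= x / p%:R < (N %/ p).+1%:R.
  apply/andP; split.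
    rewrite ler_pdivlMr // -natrM; apply: le_trans Nx.
    by rewrite ler_nat leq_trunc_div.
  rewrite ltr_pdivrMr // -natrM; apply: (lt_le_trans xN).
  by rewrite ler_nat; apply: ltn_ceil; exact: prime_gt0.
have H2 := IHs (N %/ p)%N (x / p%:R) us ps Np.
rewrite !big_cons -(unsieved_count_cons s p N) // in H1 *.
rewrite powRM ?invr_ge0 ?ler0n // in H2.
rewrite natrD in H1.
set a := _%:R in H1 *; set b := _%:R in H1 H2.
set Q := \prod_(j <- s) _ in H1 H2 *.
set E := \prod_(j <- s) _ in H1 H2 *.
have -> : a - x * ((1 - p%:R^-1) * Q) = (a + b - x * Q) - (b - x / p%:R * Q).
  by ring.
apply: le_trans (ler_normB _ _) _.
by rewrite (_ : _ * (_ * _) = x `^ th * E + x `^ th * (p%:R^-1) `^ th * E);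
  [exact: lerD | ring].
Qed.

(** Over all integers from [2] to [M] the product telescopes to [1 / M]; leaving out the composite
    factors, all below [1], can only increase it. *)
Lemma sieve_prod_ge (M : nat) : (0 < M)%N ->
  M%:R^-1 <= \prod_(p < M.+1 | prime p) (1 - p%:R^-1) :> R.
Proof.
case: M => // M _; elim: M => [|M IHM].
  by rewrite big1 ?invr1 // => i; case: i => [[|[|]]].
rewrite (big_mkcond (fun i : 'I__ => prime i)) big_ord_recr -big_mkcond /=.
have M1 : 0 < M.+1%:R :> R by [].
have M2 : 0 < M.+2%:R :> R by [].
have h : M.+2%:R^-1 = M.+1%:R^-1 * (1 - M.+2%:R^-1) :> R.
  rewrite -natr1; field.
  by rewrite nat1r natr1 !pnatr_eq0.
case: ifP => _.
  rewrite [leLHS]h; apply: ler_wpM2r => //.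
  by rewrite subr_ge0 invf_le1 // ler1n.
by rewrite mulr1; apply: le_trans IHM; rewrite lef_pV2 // ler_nat.
Qed.

(* [1 + 2 / p <= (1 + 1 / p) ^ 2], and the product over all integers telescopes. *)
Lemma sieve_prod_le (M : nat) (f : nat -> R) : (0 < M)%N ->
  (forall p, (0 < p <= M)%N -> 0 <= f p <= 2 / p%:R) ->
  \prod_(p < M.+1 | prime p) (1 + f p) <= M%:R ^+ 2.
Proof.
case: M => // M _ hf.
(* The induction needs the telescoped value itself: the product of [1 + 1 / m] for [2 <= m <= M + 1]
   is [(M + 2) / 2]. *)
suff : \prod_(p < M.+2 | prime p) (1 + f p) <= M.+2%:R ^+ 2 / 4.
  move=> /le_trans; apply; rewrite -natr1.
  have : 1 <= M.+1%:R :> R by rewrite ler1n.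
  by set u := M.+1%:R => u1; nra.
elim: M hf => [|M IHM] hf.
  rewrite big1 => [|i]; first by lra.
  by case: i => [[|[|]]].
rewrite (big_mkcond (fun i : 'I__ => prime i)) big_ord_recr -big_mkcond /=.
have {}IHM : \prod_(p < M.+2 | prime p) (1 + f p) <= M.+2%:R ^+ 2 / 4.
  by apply: IHM => p hp; apply: hf; lia.
have M2 : 0 < M.+2%:R :> R by [].
have /andP[f0 f2] := hf M.+2 (leqnn _).
rewrite -[M.+3%:R]natr1; set u := M.+2%:R in IHM M2 f2 *.
have u2 : u ^+ 2 / 4 * (1 + 2 / u) <= (u + 1) ^+ 2 / 4.
  by rewrite (_ : _ * _ = (u ^+ 2 + 2 * u) / 4); [nra|field; lra].
case: ifP => _; last by rewrite mulr1; apply: le_trans IHM _; nra.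
apply: le_trans u2; apply: ler_pM => //; last by rewrite lerD2l.
- rewrite prodr_ge0 // => i /prime_gt0 i0; rewrite addr_ge0 //.
  by have /andP[] : 0 <= f i <= 2 / i%:R by apply: hf; have := ltn_ord i; lia.
- lra.
Qed.
End Rankin.

(** * From the primorial to a list of primes *)

Definition sieve_primes (K : nat) : seq nat :=
  [seq p <- index_iota 0 K.+1 | prime p].

Lemma coprime_primorial (K m : nat) :
  coprime m (\prod_(p < K.+1 | prime p) p)%N = unsieved (sieve_primes K) m.
Proof.
rewrite /sieve_primes -(big_mkord prime id) -big_filter /unsieved.
have : all prime [seq p <- index_iota 0 K.+1 | prime p] by apply: filter_all.
elim: [seq p <- _ | _] => [|p s IHs] /=; first by rewrite big_nil coprimen1.
move=> /andP[pp ps]; rewrite big_cons coprimeMr IHs //.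
by rewrite coprime_sym prime_coprime.
Qed.

(** * Identities and bounds along one fixed 0/1 path *)

Section Walk.
Context {R : realType}.
Implicit Types (a t th : R) (f : pred nat) (b : nat -> nat).

(** The coordinate process: with bit sequences as sample points, [walk] and [visit_average] apply to
    a single path without any probability space. *)
Definition bit_at (i : nat) b : nat := b i.

Lemma walk_bit_at T (W : nat -> T -> nat) i w :
  walk W i w = walk bit_at i (W^~ w).
Proof. by elim: i => //= i ->. Qed.

Lemma eq_walk n b b' : (forall i, (i < n)%N -> b i = b' i) ->
  walk bit_at n b = walk bit_at n b'.
Proof.
elim: n => //= n IHn bb'; rewrite IHn => [|i i_n].
  by rewrite /bit_at bb'.
exact/bb'/ltnW.

Qed.

Lemma walk_le n b : (forall i, b i <= 1)%N -> (walk bit_at n b <= n)%N.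
Proof.
move=> b1; elim: n => //= n IHn; have := b1 n; rewrite -[b n]/(bit_at n b); lia.
Qed.

(** A martingale transform: [f] is read at the position before step [i], so it depends only on
    earlier bits. *)
Definition fluct a f n b : R :=
  \sum_(i < n) (a - (b i)%:R) * (f (walk bit_at i b))%:R.

Lemma fluctS a f n b :
  fluct a f n.+1 b = fluct a f n b + (a - (b n)%:R) * (f (walk bit_at n b))%:R.
Proof. by rewrite /fluct big_ord_recr. Qed.

Lemma eq_fluct a f n b b' : (forall i, (i < n)%N -> b i = b' i) ->
  fluct a f n b = fluct a f n b'.
Proof.
move=> bb'; apply: eq_bigr => i _; rewrite bb' // (@eq_walk _ _ b') // => j ji.
by rewrite bb' // (ltn_trans ji).
Qed.

(** A new bit [0] adds [a] times the current value of [f] to [fluct]; a new bit [1] adds [a - 1]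
    times it there and the missing unit to the count. *)
Lemma visits_fluct a f n b : (forall i, b i <= 1)%N ->
  a * (\sum_(i < n) (f (walk bit_at i b))%:R) =
    \sum_(m < walk bit_at n b) (f m)%:R + fluct a f n b.
Proof.
move=> b1; elim: n => [|n IHn] /=.
  by rewrite /fluct !big_ord0 mulr0 addr0.
rewrite big_ord_recr /= mulrDr IHn fluctS /bit_at.
have := b1 n; rewrite -[b n]/(bit_at n b); case: (bit_at n b) => [|[|]] // _.
  by rewrite addn0 subr0 addrA.
by rewrite addn1 big_ord_recr /=; ring.
Qed.

Lemma sum_ord_shift (g : nat -> R) n :
  g 0%N + \sum_(1 <= i < n.+1) g i = \sum_(i < n) g i + g n.
Proof.
by rewrite -(big_mkord xpredT g) -big_nat_recr // [RHS]big_ltn.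
Qed.

(** Two cases of [visits_fluct] are compared: the sifted set gives the visits, and the full set
    gives [a * n = N + G] for the final position [N]. Then [N] is replaced by [a * n] in the sieve's
    main term [N * c]. *)
Lemma visit_average_bound (beta a t th : R) (n : nat) b
    (A := sifted beta n%:R) (M := Num.truncn (sieve_level beta n%:R)) :
  (0 < n)%N -> 0 < a < 1 -> 0 <= th <= 1 -> (0 < M)%N ->
  (forall i, b i <= 1)%N ->
  (forall p, (0 < p <= M)%N -> (p%:R^-1) `^ th <= 2 / p%:R :> R) ->
  `|fluct a (fun m => m \in A) n b| <= t -> `|fluct a xpredT n b| <= t ->
  `|visit_average beta bit_at n b - sieve_density beta n%:R| <=
     (2 * t + 2 + n%:R `^ th * M%:R ^+ 2) / (a * n%:R).
Proof.
move=> n0 /andP[a0 a1] th01 M0 b1 hth.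
set f := fun m => m \in A => f_t T_t.
set c := sieve_density _ _.
have nR0 : 0 < n%:R :> R by rewrite ltr0n.
have f01 m : 0 <= ((f m)%:R : R) <= 1 by case: (f m); rewrite ?lexx ?ler01.
set N := walk bit_at n b.
have Nn : (N <= n)%N by exact: walk_le.
(* As [0] is not sifted, passing from indices [0..n-1] to [1..n] only adds the last term. *)
have f0 : f 0%N = false.
  by rewrite /f; apply/negbTE/negP; rewrite inE => -[].
(* The cutoff at [n] in [sifted] is harmless, because the walk stays at most [n] up to time [n]. *)
have fE m : (0 < m <= n)%N -> f m = unsieved (sieve_primes M) m.
  move=> /andP[m0 mn]; rewrite -coprime_primorial; apply/idP/idP.
    by rewrite /f inE => -[_ _ /eqP].
  move=> /eqP mc; rewrite /f inE; split => //.
  by rewrite ler_nat.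
have cE : c = \prod_(p <- sieve_primes M) (1 - p%:R^-1).
  by rewrite /c /sieve_density /sieve_primes big_filter big_mkord.
have c01 : 0 <= c <= 1.
  rewrite cE /sieve_primes; apply/andP; split.
    rewrite big_filter prodr_ge0 // => p pp.
    by rewrite subr_ge0 invf_le1 ?ltr0n ?ler1n prime_gt0.
  rewrite big_filter Num.Theory.prodr_ile1 // => p pp.
  by rewrite subr_ge0 invf_le1 ?ltr0n ?ler1n ?prime_gt0 //= gerBl invr_ge0.
have countE : \sum_(m < N) (f m)%:R + (f N)%:R =
    (unsieved_count (sieve_primes M) N)%:R :> R.
  rewrite -(sum_ord_shift (fun m => (f m)%:R)) f0 add0r /unsieved_count natr_sum.
  by apply: eq_big_nat => m mN; rewrite fE //; lia.
have := @visits_fluct a f n b b1; have := @visits_fluct a xpredT n b b1.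
rewrite !sumr_const !card_ord -/N => HT Hf.
have Hsum : \sum_(1 <= i < n.+1) (f (walk bit_at i b))%:R =
    \sum_(i < n) (f (walk bit_at i b))%:R + (f N)%:R :> R.
  by rewrite -(sum_ord_shift (fun i => (f (walk bit_at i b))%:R)) /= f0 add0r.
have Hsieve : `|(unsieved_count (sieve_primes M) N)%:R - N%:R * c| <=
    n%:R `^ th * M%:R ^+ 2.
  rewrite cE; apply: le_trans (rankin_sieve th _ N N%:R th01 _ _ _) _.
  - exact/filter_uniq/iota_uniq.
  - exact: filter_all.
  - by rewrite lexx ltr_nat ltnSn.
  apply: ler_pM; first exact: powR_ge0.
  - by rewrite prodr_ge0 // => p _; rewrite addr_ge0 // powR_ge0.
  - have /andP[th0 _] := th01.
    by apply: ge0_ler_powR => //; rewrite ?nnegrE // ler_nat.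
  rewrite /sieve_primes big_filter big_mkord.
  by apply: (sieve_prod_le M (fun p => (p%:R^-1) `^ th)) => // p pM;
    rewrite powR_ge0 hth.
rewrite /visit_average -/A ler_pdivlMr ?mulr_gt0 //.
rewrite -[a * n%:R]gtr0_norm ?mulr_gt0 // -normrM.
have -> : (\sum_(1 <= i < n.+1) \1_A (walk bit_at i b) : R) =
    \sum_(1 <= i < n.+1) (f (walk bit_at i b))%:R by [].
set S := \sum_(1 <= i < n.+1) _ in Hsum *.
have -> : (n%:R^-1 * S - c) * (a * n%:R) = a * S - a * n%:R * c.
  by field; rewrite gt_eqF.
rewrite Hsum mulrDr Hf; move: countE Hsieve HT f_t T_t c01 (f01 N).
set cnt := (unsieved_count _ _)%:R; set u := \sum_(m < N) _.
set F := fluct _ f _ _; set G := fluct _ xpredT _ _; set E := n%:R `^ _ * _.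
set x := (f N)%:R; set NR := N%:R; set nR := n%:R.
rewrite !ler_norml => cntE /andP[S1 S2] HT /andP[F1 F2] /andP[G1 G2].
move=> /andP[c0 c1] /andP[x0 x1].
have {}HT : a * nR = NR + G by exact: HT.
have -> : u = cnt - x by rewrite -cntE; ring.
(* In order: the sieve error, the endpoint [N] of the count, the fluctuation on the sifted set, the
   last visit, and the fluctuation of the position. *)
rewrite HT (_ : _ - _ = (cnt - NR * c) - x + F + a * x - G * c); last by ring.
have : - t <= G * c <= t by apply/andP; split; nra.
have : 0 <= a * x <= 1 by apply/andP; split; nra.
move=> /andP[? ?] /andP[? ?]; apply/andP; split; lra.
Qed.
End Walk.

(** * Exponential tail bounds for the fluctuations *)

Section Tail.
Context {R : realType} {d : measure_display} {T : measurableType d}.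
Context (P : probability T R) (W : nat -> {RV P >-> nat}) (alpha : R).
Hypothesis halpha : 0 < alpha < 1.
Hypothesis W_indep : mutually_independent W.
Hypothesis W_one : forall i, P (W i @^-1` [set 1%N]) = alpha%:E.
Hypothesis W_zero : forall i, P (W i @^-1` [set 0%N]) = (1 - alpha)%:E.

Let bits (w : T) : nat -> nat := W^~ w.

Definition cylinder (b : nat -> nat) (j : nat) : set T :=
  [set w | forall i, (i < j)%N -> W i w = b i].

Definition nonbinary (i : nat) : set T := [set w | (1 < W i w)%N].

Lemma measurable_preimage_RV i (A : set nat) : measurable (W i @^-1` A).
Proof. by rewrite -[_ @^-1` _]setTI; exact: measurable_funP. Qed.

Lemma cylinderE b j :
  cylinder b j = \bigcap_(i in [set` [fset k in iota 0 j]%fset])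
                   (W i @^-1` [set b i]).
Proof.
apply/seteqP; split => w /= H i; first by rewrite /= !inE mem_iota => /H.
by move=> ij; apply: H; rewrite /= !inE mem_iota.
Qed.

Lemma measurable_cylinder b j : measurable (cylinder b j).
Proof.
rewrite cylinderE; apply: fin_bigcap_measurable => // i _.
exact: measurable_preimage_RV.
Qed.

(** Independence enters the proof through this one-step factorization. *)
Lemma cylinderS b j :
  P (cylinder b j.+1) = (P (cylinder b j) * P (W j @^-1` [set b j]))%E.
Proof.
rewrite !cylinderE !(W_indep _ (fun i => [set b i])) //.
have bigE k (F : nat -> \bar R) :
    (\prod_(i <- [fset x in iota 0 k]%fset) F i = \prod_(i <- iota 0 k) F i)%E.
  by rewrite eq_big_imfset //= big_map undup_id ?iota_uniq.
by rewrite !bigE -[j.+1]addn1 iotaD big_cat big_seq1.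
Qed.

(** The masses at [0] and [1] already add up to [1]. *)
Lemma nonbinary0 i : P (nonbinary i) = 0.
Proof.
have -> : nonbinary i = ~` (W i @^-1` [set 0%N] `|` W i @^-1` [set 1%N]).
  apply/seteqP; split => w; rewrite /nonbinary /=; case: (W i w) => [|[|k]] //.
  - by move=> _ [].
  - by case; left.
  - by case; right.
have m0 := measurable_preimage_RV i [set 0%N].
have m1 := measurable_preimage_RV i [set 1%N].
have disj : W i @^-1` [set 0%N] `&` W i @^-1` [set 1%N] = set0.
  by apply/seteqP; split => w //= -[->].
have U1 : P (W i @^-1` [set 0%N] `|` W i @^-1` [set 1%N]) = 1%E.
  by rewrite -[RHS](_ : (1 - alpha)%:E + alpha%:E = 1)%E;
    [rewrite -(W_zero i) -(W_one i); exact: measureU | rewrite -EFinD subrK].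
by rewrite probability_setC ?U1 ?subee //; exact: measurableU.
Qed.

Lemma probabilityU_le (A B : set T) : measurable A -> measurable B ->
  (P (A `|` B) <= P A + P B)%E.
Proof. by move=> mA mB; exact: measureU2. Qed.

(** From [1 - x <= expR (- x)] one gets [(1 - x) * expR x <= 1], while [(1 - x) * (1 + x + 2 * x ^+
    2) = 1 + x ^+ 2 * (1 - 2 * x) >= 1]. *)
Lemma expR_le_quad (x : R) : `|x| <= 2^-1 -> expR x <= 1 + x + 2 * x ^+ 2.
Proof.
rewrite ler_norml => /andP[x1 x2].
have := expR_ge1Dx (- x); have := expR_gt0 x; rewrite expRN => e0 e1.
have : (1 - x) * expR x <= 1.
  by apply: le_trans (ler_wpM2r (ltW e0) e1) _; rewrite mulVf ?gt_eqF.
nra.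
Qed.

(** The linear terms cancel because the step is centred, and the quadratic ones sum to [2 * alpha *
    (1 - alpha) * lam ^+ 2 <= lam ^+ 2 / 2]. Here [u] stands for the indicator read before the
    step. *)
Lemma step_mgf (lam u : R) : `|lam| <= 2^-1 -> u = 0 \/ u = 1 ->
  (1 - alpha) * expR (lam * (alpha * u)) + alpha * expR (lam * ((alpha - 1) * u))
    <= expR (lam ^+ 2).
Proof.
move=> hl; have /andP[a0 a1] := halpha.
have hx := expR_ge1Dx (lam ^+ 2); have l2 := sqr_ge0 lam.
case=> ->; rewrite ?mulr0 ?mulr1 ?expR0; first by lra.
move: hl; rewrite ler_norml => /andP[l_ge l_le].
have h1 : `|lam * alpha| <= 2^-1 by rewrite ler_norml; apply/andP; split; nra.
have h2 : `|lam * (alpha - 1)| <= 2^-1.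
  by rewrite ler_norml; apply/andP; split; nra.
have := expR_le_quad _ h1; have := expR_le_quad _ h2.
set e1 := expR _; set e2 := expR _; set e3 := expR _ => H1 H2.
have {}H1 : alpha * e1 <=
    alpha * (1 + lam * (alpha - 1) + 2 * (lam * (alpha - 1)) ^+ 2).
  by rewrite ler_pM2l.
have {}H2 : (1 - alpha) * e2 <=
    (1 - alpha) * (1 + lam * alpha + 2 * (lam * alpha) ^+ 2).
  by rewrite ler_pM2l // subr_gt0.
apply: (@le_trans _ _ (1 + 2 * (alpha * (1 - alpha)) * lam ^+ 2)).
  apply: le_trans (lerD H2 H1) _.
  rewrite le_eqVlt; apply/orP; left; apply/eqP; ring.
have a4 : alpha * (1 - alpha) <= 4^-1.
  by have := sqr_ge0 (alpha - 2^-1); nra.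
have := ler_wpM2r l2 a4; rewrite -/e3 in hx *; lra.
Qed.

(* Chernoff's bound, proved by a backward induction over cylinders so that no
   expectation has to be computed. *)
Lemma tail_cylinder (f : pred nat) (lam t : R) n j b : `|lam| <= 2^-1 ->
  exists2 B : set T, measurable B &
    (cylinder b j `&` [set w | t < lam * fluct alpha f (j + n) (bits w)] `<=` B) /\
    (P B <= P (cylinder b j) *
      (expR (lam * fluct alpha f j b - t + n%:R * lam ^+ 2))%:E)%E.
Proof.
move=> hl; elim: n j b => [|n IHn] j b.
  rewrite addn0 mul0r addr0.
  (* No step remains, so [fluct] is constant on the cylinder and the event is all of it, with a
     nonnegative exponent in the bound, or empty. *)
  have [tb|bt] := ltP t (lam * fluct alpha f j b).
    exists (cylinder b j); first exact: measurable_cylinder.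
    split; first exact: subIsetl.
    rewrite -[leLHS]mule1 lee_wpmul2l // lee_fin.
    by rewrite -expR0 ler_expR subr_ge0 ltW.
  exists set0 => //; split; last by rewrite measure0 mule_ge0 // lee_fin expR_ge0.
  move=> w [/= wb]; rewrite (eq_fluct _ _ _ _ b) => [|i ij]; last exact: wb.
  by rewrite ltNge bt.
(* The cylinder splits into the two children with bit [0] or [1] at time [j], up to the null set
   [nonbinary j]. *)
pose ext k i := if (i == j)%N then k else b i : nat.
have extb k i : (i < j)%N -> ext k i = b i.
  by move=> ij; rewrite /ext ltn_eqF.
have extj k : ext k j = k by rewrite /ext eqxx.
have cyl_ext k : cylinder (ext k) j = cylinder b j.
  by apply/seteqP; split => w H i ij; rewrite H // extb.
have [B0 mB0 [sB0 PB0]] := IHn j.+1 (ext 0%N).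
have [B1 mB1 [sB1 PB1]] := IHn j.+1 (ext 1%N).
have mN : measurable (nonbinary j).
  by rewrite (_ : nonbinary j = W j @^-1` [set k | (1 < k)%N]) //;
    exact: measurable_preimage_RV.
exists (B0 `|` B1 `|` nonbinary j).
  by apply: measurableU => //; exact: measurableU.
split.
  move=> w [wb]; rewrite /= addnS -addSn => wt.
  have extw k : W j w = k -> cylinder (ext k) j.+1 w.
    move=> wk i; rewrite ltnS leq_eqVlt => /orP[/eqP ->|ij].
      by rewrite extj.
    by rewrite extb //; exact: wb.
  case wj : (W j w) => [|[|k]].
  - by left; left; apply: sB0; split => //; exact: extw.
  - by left; right; apply: sB1; split => //; exact: extw.
  - by right; rewrite /nonbinary /= wj.
apply: le_trans (probabilityU_le _ _ _ _) _ => //; first exact: measurableU.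
rewrite nonbinary0 adde0; apply: le_trans (probabilityU_le _ _ _ _) _ => //.
apply: le_trans (leeD PB0 PB1) _.
rewrite !cylinderS !cyl_ext !extj W_zero W_one !fluctS !extj.
rewrite (eq_walk j (ext 0%N) b) //; last by move=> i /(extb 0%N).
rewrite (eq_walk j (ext 1%N) b) //; last by move=> i /(extb 1%N).
rewrite (eq_fluct _ _ _ (ext 0%N) b) //; last by move=> i /(extb 0%N).
rewrite (eq_fluct _ _ _ (ext 1%N) b) //; last by move=> i /(extb 1%N).
have /andP[a0 a1] := halpha.
rewrite -!muleA -ge0_muleDr; last 2 first.
- by rewrite -EFinM lee_fin mulr_ge0 ?expR_ge0 // subr_ge0 ltW.
- by rewrite -EFinM lee_fin mulr_ge0 ?expR_ge0 // ltW.
rewrite lee_wpmul2l // -!EFinM -EFinD lee_fin subr0.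
set F := fluct _ _ _ _; set u := _%:R.
have u01 : u = 0 \/ u = 1 by rewrite /u; case: (f _); [right|left].
(* Averaging over the bit at time [j] costs one factor [expR (lam ^+ 2)], which turns [n] into
   [n.+1] in the exponent. *)
have := step_mgf lam u hl u01.
set C := expR (lam * F - t + n%:R * lam ^+ 2).
have -> : expR (lam * (F + alpha * u) - t + n%:R * lam ^+ 2) =
    C * expR (lam * (alpha * u)) by rewrite -expRD; congr expR; ring.
have -> : expR (lam * (F + (alpha - 1) * u) - t + n%:R * lam ^+ 2) =
    C * expR (lam * ((alpha - 1) * u)) by rewrite -expRD; congr expR; ring.
have -> : expR (lam * F - t + n.+1%:R * lam ^+ 2) = C * expR (lam ^+ 2).
  by rewrite -expRD -natr1; congr expR; ring.
move=> H; rewrite mulrCA [X in _ + X]mulrCA -mulrDr ler_pM2l //.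
exact: expR_gt0.
Qed.

(** The one-sided bound is used for [lam] and [- lam] on the cylinder of length [0], which is the
    whole space. *)
Lemma tail_bound (f : pred nat) (lam t : R) n : `|lam| <= 2^-1 ->
  exists2 B : set T, measurable B &
    ([set w | t < `|lam * fluct alpha f n (bits w)|] `<=` B) /\
    (P B <= (2 * expR (n%:R * lam ^+ 2 - t))%:E)%E.
Proof.
move=> hl; have hl' : `|- lam| <= 2^-1 by rewrite normrN.
have [B mB [sB PB]] := tail_cylinder f lam t n 0 (fun=> 0%N) hl.
have [B' mB' [sB' PB']] := tail_cylinder f (- lam) t n 0 (fun=> 0%N) hl'.
exists (B `|` B'); first exact: measurableU.
have c0 : cylinder (fun=> 0%N) 0 = setT by apply/seteqP; split.
split.
  move=> w /=; rewrite lter_normr => /orP[wt|wt].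
    by left; apply: sB; rewrite c0.
  by right; apply: sB'; rewrite c0 /= mulNr.
apply: le_trans (probabilityU_le _ _ _ _) _ => //.
apply: le_trans (leeD PB PB') _.
rewrite c0 probability_setT !mul1e -EFinD lee_fin sqrrN /fluct !big_ord0 !mulr0.
by rewrite !sub0r [- t + _]addrC -mulr2n -[leLHS]mulr_natl.
Qed.
End Tail.

(** * Borel-Cantelli *)

Section AlmostSure.
Context {R : realType} {d : measure_display} {T : measurableType d}.
Context (P : probability T R) (W : nat -> {RV P >-> nat}) (alpha : R).
Hypothesis halpha : 0 < alpha < 1.
Hypothesis W_indep : mutually_independent W.
Hypothesis W_one : forall i, P (W i @^-1` [set 1%N]) = alpha%:E.
Hypothesis W_zero : forall i, P (W i @^-1` [set 0%N]) = (1 - alpha)%:E.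

(** Chosen for [lam = 1 / sqrt n]: the [1] cancels [n * lam ^+ 2], and the logarithm leaves the
    summable tail [2 / (n + 2) ^ 2]. *)
Definition fluct_level (n : nat) : R :=
  Num.sqrt n%:R * (1 + 2 * ln n.+2%:R).

(** The tail is stated as a telescoping difference, so that summing it over [n] is immediate. The
    restriction [4 <= n] makes [1 / sqrt n] at most [1 / 2]. *)
Lemma tail_bound_level (f : pred nat) (n : nat) :
  exists2 B : set T, measurable B &
    ((4 <= n)%N ->
      [set w | fluct_level n < `|fluct alpha f n (W^~ w)|] `<=` B) /\
    (P B <= (2 * (n.+1%:R^-1 - n.+2%:R^-1))%:E)%E.
Proof.
have le_n : n.+2%:R ^- 2 <= n.+1%:R^-1 - n.+2%:R^-1 :> R.
  rewrite -[n.+2%:R]natr1; have : 0 < n.+1%:R :> R by [].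
  move: n.+1%:R => u u0; have u1 : 0 < u + 1 by lra.
  have -> : u^-1 - (u + 1)^-1 = (u * (u + 1))^-1 by field; rewrite !gt_eqF.
  by rewrite lef_pV2 ?posrE ?mulr_gt0 ?exprn_gt0 //; nra.
have [n4|n4] := leqP 4 n; last first.
  exists set0 => //; split => //; rewrite measure0 lee_fin mulr_ge0 //.
  by apply: le_trans le_n; rewrite invr_ge0 sqr_ge0.
have n0 : 0 < n%:R :> R by rewrite ltr0n (leq_trans _ n4).
set s := Num.sqrt n%:R : R.
have s0 : 0 < s by rewrite sqrtr_gt0.
have s2 : s ^+ 2 = n%:R by rewrite sqr_sqrtr // ltW.
have hs : `|s^-1| <= 2^-1.
  rewrite gtr0_norm ?invr_gt0 // lef_pV2 ?posrE //.
  by have n4R : 4%:R <= n%:R :> R; [rewrite ler_nat | rewrite -s2 in n4R; nra].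
have [B mB [sB PB]] := tail_bound P W alpha halpha W_indep W_one W_zero f s^-1
  (1 + 2 * ln n.+2%:R) n hs.
exists B => //; split => [_ w /= wt|].
  apply: sB => /=; rewrite normrM gtr0_norm ?invr_gt0 //.
  by rewrite ltr_pdivlMl.
apply: le_trans PB _; rewrite lee_fin ler_pM2l //; apply: le_trans le_n.
rewrite exprVn s2 mulfV ?gt_eqF // opprD addrA subrr add0r.
by rewrite expRN lef_pV2 ?posrE ?expR_gt0 ?exprn_gt0 //
  mulr_natl mulr2n expRD lnK ?posrE // expr2.
Qed.

Lemma ae_fluct_le (f : nat -> pred nat) :
  {ae P, forall w, \forall n \near \oo,
     `|fluct alpha (f n) n (W^~ w)| <= fluct_level n}.
Proof.
have /choice[B HB] n : exists B : set T, [/\ measurable B,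
    (4 <= n)%N -> [set w | fluct_level n < `|fluct alpha (f n) n (W^~ w)|] `<=` B &
    (P B <= (2 * (n.+1%:R^-1 - n.+2%:R^-1))%:E)%E].
  by have [B mB [sB PB]] := tail_bound_level (f n) n; exists B.
exists (lim_sup_set B); split.
- apply: bigcap_measurable => // n _; apply: bigcup_measurable => k _.
  by have [] := HB k.
- apply: lim_sup_set_cvg0 => [k|]; first by have [] := HB k.
  apply: (@le_lt_trans _ _ 2%:E); last exact: ltry.
  apply: lime_le; first by apply: is_cvg_nneseries => n _ _; exact: measure_ge0.
  apply: nearW => n.
  apply: (@le_trans _ _ (\sum_(0 <= k < n) (2 * (k.+1%:R^-1 - k.+2%:R^-1))%:E)%E).
    by apply: lee_sum => k _; have [] := HB k.
  rewrite sumEFin lee_fin -mulr_sumr.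
  have := @telescope_sumr _ 0 n (fun k => - k.+1%:R^-1 : R) (leq0n n).
  under eq_bigr do rewrite opprK addrC.
  by move=> ->; rewrite opprK invr1 -[leRHS]mulr1 ler_pM2l // gerDr
    oppr_le0 invr_ge0.
move=> w /= Hw n _; apply: contrapT => Hn; apply: Hw.
(* By contraposition [w] lies in no [B k] with [k >= n]; from [4] on these sets cover the bad
   events, so the bound holds at [w]. *)
exists (maxn n 4) => // k /=; rewrite geq_max => /andP[nk k4].
rewrite leNgt; apply/negP => kw; apply: Hn; exists k => //.
by have [_ /(_ k4) sB _] := HB k; exact: sB.
Qed.

Lemma ae_binary : {ae P, forall w, forall i, (W i w <= 1)%N}.
Proof.
apply: ae_foralln => i; exists (nonbinary P W i); split.
- by rewrite (_ : nonbinary P W i = W i @^-1` [set k | (1 < k)%N]) //;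
    exact: measurable_preimage_RV.
- exact: nonbinary0 W_one W_zero i.
- by move=> w /= /negP; rewrite -ltnNge.
Qed.
End AlmostSure.

(** * Real estimates for large [n] *)

Section Asymptotics.
Context {R : realType}.
Implicit Types (beta L x k M l : R).

(** To be read with [L = ln n], [x = L ^ beta], [k = L ^ (1 - 2 * beta)], [M] the integer part of
    [expR x] and [l = ln (n + 2)]. The condition [8 <= k] lets [x * k / 2 >= 4 * x] absorb [M ^ 3]
    and still leave [expR (- x)]. The constant is [67 = 2 * 32 + 2 + 1]. *)
Lemma error_exp_bound L x k M l :
  1 <= x -> 8 <= k -> L = x * (x * k) -> 0 <= M <= expR x -> 0 <= l <= 2 * L ->
  M * (2 * (expR (L / 2) * (1 + 2 * l)) + 2 + expR (L - x * k / 2) * M ^+ 2)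
    <= 67 * expR (L - x).
Proof.
move=> x1 k8 LE /andP[M0 Mx] /andP[l0 lL].
have xx : x <= x * x by nra.
have xk : 8 * x <= x * k by nra.
have L8 : 8 * (x * x) <= L by rewrite LE; nra.
have h1 : M * (expR (L / 2) * (1 + 2 * l)) <= 32 * expR (L - x).
  (* Indeed [1 + 2 * l <= 1 + 4 * L <= 32 * (1 + L / 8)]. *)
  have hl : 1 + 2 * l <= 32 * expR (L / 8).
    by have := expR_ge1Dx (L / 8); lra.
  apply: (@le_trans _ _ (expR x * (expR (L / 2) * (32 * expR (L / 8))))).
    by apply: ler_pM => //; rewrite ?mulr_ge0 ?expR_ge0 ?ler_pM2l ?expR_gt0 //; lra.
  rewrite (_ : _ * _ = 32 * (expR x * expR (L / 2) * expR (L / 8))); last by ring.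
  by rewrite -!expRD ler_pM2l // ler_expR; lra.
have h2 : M <= expR (L - x).
  by apply: (le_trans Mx); rewrite ler_expR; lra.
have h3 : M * (expR (L - x * k / 2) * M ^+ 2) <= expR (L - x).
  rewrite (_ : M * _ = expR (L - x * k / 2) * (M * M * M)); last by ring.
  apply: (@le_trans _ _ (expR (L - x * k / 2) * (expR x * expR x * expR x))).
    by rewrite ler_pM2l ?expR_gt0 // !ler_pM ?mulr_ge0.
  by rewrite -!expRD ler_expR; lra.
lra.
Qed.

Lemma near_ge_ln_powR (A g : R) : 0 < A -> 0 < g ->
  \forall n \near \oo, A <= ln (n%:R : R) `^ g.
Proof.
move=> A0 g0; near=> n.
have hn : expR (A `^ g^-1) <= n%:R by near: n; exact: nbhs_infty_ger.
have hL : A `^ g^-1 <= ln n%:R.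
  by rewrite -[leLHS]expRK ler_ln // posrE ?expR_gt0 //
    (lt_le_trans (expR_gt0 _) hn).
have -> : A = (A `^ g^-1) `^ g by rewrite -powRrM mulVf ?gt_eqF // powRr1 // ltW.
apply: ge0_ler_powR => //; first exact: ltW.
  by rewrite nnegrE powR_ge0.
by rewrite nnegrE (le_trans _ hL) // powR_ge0.
Unshelve. all: by end_near. Qed.

End Asymptotics.

(** * The relative error along one path *)

Section Density.
Context {R : realType}.
Implicit Types (beta x : R).

(** With [s = 1 / (2 * x)], the excess factor [p ^ s] is at most [expR (1 / 2)], and
    [expR (- 1 / 2) >= 1 / 2]. *)
Lemma rankin_weight_le x (p : nat) : 1 <= x -> (0 < p)%N -> p%:R <= expR x ->
  (p%:R^-1) `^ (1 - (2 * x)^-1) <= 2 / p%:R :> R.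
Proof.
move=> x1 p0 px; have pR0 : 0 < p%:R :> R by rewrite ltr0n.
have q0 : 0 < p%:R^-1 :> R by rewrite invr_gt0.
have x0 : 0 < x by lra.
have half : 2^-1 <= (p%:R^-1) `^ (2 * x)^-1 :> R.
  apply: (@le_trans _ _ (expR (- x) `^ (2 * x)^-1)).
    rewrite -expRM (_ : - x * _ = - 2^-1); last by field; rewrite gt_eqF.
    by have := expR_ge1Dx (- 2^-1 : R); lra.
  apply: ge0_ler_powR; rewrite ?nnegrE ?expR_ge0 ?invr_ge0 ?ler0n //.
    by rewrite mulr_ge0 // ltW.
  by rewrite expRN lef_pV2 ?posrE ?expR_gt0.
rewrite powRB; last by rewrite (gt_eqF q0) implybT.
rewrite (powRr1 (ltW q0)) [leLHS]mulrC ler_pM2r // -[leRHS]invrK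
  lef_pV2 ?posrE ?invr_gt0 //.
exact: powR_gt0.
Qed.

Lemma sieve_density_gt0 beta x : 0 < sieve_density beta x.
Proof.
rewrite /sieve_density prodr_gt0 // => p pp.
have p1 := prime_gt1 pp; have p0 := prime_gt0 pp.
by rewrite subr_gt0 invf_lt1 ?ltr1n ?ltr0n.
Qed.

Lemma relative_error_le beta (a : R) (n : nat) (b : nat -> nat)
    (L := ln n%:R : R) (x := L `^ beta) :
  (2 <= n)%N -> 0 < a < 1 -> (forall i, b i <= 1)%N ->
  1 <= L -> 1 <= x -> 8 <= L `^ (1 - 2 * beta) ->
  `|fluct a (fun m => m \in sifted beta (n%:R : R)) n b| <= fluct_level n ->
  `|fluct a xpredT n b| <= fluct_level n ->
  `|visit_average beta bit_at n b / sieve_density beta n%:R - 1|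
    <= 67 / a * expR (- x).
Proof.
move=> n2 a01 b1 L1 x1 k8 fA fT.
have n0 : (0 < n)%N by exact: ltnW.
have nR0 : 0 < n%:R :> R by rewrite ltr0n.
have x0 : 0 < x by lra.
have /andP[a0 a1] := a01.
have eL : expR L = n%:R by rewrite lnK.
set y := sieve_level beta (n%:R : R).
have yE : y = expR x by [].
have y1 : 1 <= y by rewrite yE -[leLHS]expR0 ler_expR ltW.
set M := Num.truncn y.
have M0 : (0 < M)%N by rewrite truncn_gt0.
have My : M%:R <= y by rewrite truncn_le // (le_trans ler01).
have c0 := sieve_density_gt0 beta (n%:R : R).
have cM : M%:R^-1 <= sieve_density beta (n%:R : R) by exact: sieve_prod_ge.
have th01 : 0 <= 1 - (2 * x)^-1 <= 1.
  have : (2 * x)^-1 <= 1 by rewrite invf_le1; lra.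
  have : 0 <= (2 * x)^-1 by rewrite invr_ge0; lra.
  by move=> *; apply/andP; split; lra.
have hth p : (0 < p <= M)%N -> (p%:R^-1) `^ (1 - (2 * x)^-1) <= 2 / p%:R :> R.
  move=> /andP[p0 pM]; apply: rankin_weight_le => //; rewrite -yE.
  by apply: le_trans My; rewrite ler_nat.
have := visit_average_bound _ _ _ _ _ _ n0 a01 th01 M0 b1 hth fA fT.
set v := visit_average _ _ _ _; set c := sieve_density _ _ in c0 cM *.
rewrite -/M => hv.
have -> : v / c - 1 = (v - c) / c by field; rewrite gt_eqF.
have MR0 : 0 < M%:R :> R by rewrite ltr0n.
rewrite normrM normfV (gtr0_norm c0) //.
(* Since [c >= 1 / M], dividing by [c] costs at most a factor [M]. *)
apply: (@le_trans _ _ (`|v - c| * M%:R)).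
  by rewrite ler_wpM2l // -[leRHS]invrK lef_pV2 ?posrE ?invr_gt0.
apply: le_trans (ler_wpM2r (ltW MR0) hv) _.
rewrite mulrAC ler_pdivrMr ?mulr_gt0 //.
have -> : 67 / a * expR (- x) * (a * n%:R) = 67 * expR (L - x).
  by rewrite expRD eL; field; rewrite gt_eqF.
rewrite mulrC.
have LE : L = x * (x * L `^ (1 - 2 * beta)).
  have Ln0 : L != 0 by rewrite gt_eqF //; lra.
  rewrite /x -!powRD ?Ln0 ?implybT // (_ : beta + _ = 1); last by ring.
  by rewrite powRr1 //; lra.
have sE : Num.sqrt n%:R = expR (L / 2).
  rewrite -eL (_ : expR L = expR (L / 2) ^+ 2); last first.
    by rewrite expr2 -expRD; congr expR; field.
  by rewrite sqrtr_sqr ger0_norm ?expR_ge0.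
have pE : n%:R `^ (1 - (2 * x)^-1) = expR (L - x * L `^ (1 - 2 * beta) / 2).
  rewrite /powR gt_eqF // -/L; congr expR.
  have E (u z k : R) : z != 0 -> u = z * (z * k) ->
      (1 - (2 * z)^-1) * u = u - z * k / 2 by move=> z0 ->; field.
  by apply: E => //; rewrite gt_eqF.
rewrite /fluct_level sE pE.
apply: error_exp_bound => //; first by rewrite ltW.
(* It remains that [n + 2 <= n ^ 2], true from [n = 2] on. *)
rewrite ln_ge0 ?ler1n //= mulr_natl -lnXn //.
rewrite ler_ln ?posrE ?exprn_gt0 //.
have : 2 <= n%:R :> R by rewrite ler_nat.
by rewrite -[n.+2]addn2 natrD; clear; move: n%:R => u u2; nra.
Qed.
End Density.

Theorem theorem1p3 (R : realType) (beta alpha : R)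
    (hbeta : 0 < beta < 2^-1) (halpha : 0 < alpha < 1)
    (d : measure_display) (T : measurableType d) (P : probability T R)
    (W : nat -> {RV P >-> nat})
    (W_indep : mutually_independent W)
    (W_one : forall i : nat, P (W i @^-1` [set 1%N]) = alpha%:E)
    (W_zero : forall i : nat, P (W i @^-1` [set 0%N]) = (1 - alpha)%:E) :
  {ae P, forall w : T, exists e : nat -> R,
    (e n @[n --> \oo] --> (0 : R)) /\
    forall n : nat, (1 <= n)%N ->
      visit_average beta (fun i => W i : T -> nat) n w =
        sieve_density beta n%:R * (1 + e n)}.
Proof.
have /andP[b0 b2] := hbeta; have /andP[a0 a1] := halpha.
have aeA := ae_fluct_le P W alpha halpha W_indep W_one W_zero
  (fun n m => m \in sifted beta (n%:R : R)).
have aeT := ae_fluct_le P W alpha halpha W_indep W_one W_zero (fun=> xpredT).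
have aeB := ae_binary P W alpha W_one W_zero.
apply: filterS3 aeA aeT aeB => w fA fT b1.
exists (fun n => visit_average beta bit_at n (W^~ w) / sieve_density beta n%:R - 1).
split; last first.
  move=> n n1; rewrite addrC subrK mulrC divfK ?gt_eqF ?sieve_density_gt0 //.
  congr (_ * _); apply: eq_bigr => i _.
  by rewrite walk_bit_at.
apply/cvgr0Pnorm_le => eps eps0; near=> n.
apply: le_trans (relative_error_le beta alpha n _ _ halpha b1 _ _ _ _ _) _.
- by near: n; exact: nbhs_infty_ge.
- rewrite -[leRHS]powRr1; first by near: n; exact: near_ge_ln_powR.
  by rewrite ln_ge0 // ler1n; near: n; exact: nbhs_infty_ge.
- by near: n; exact: near_ge_ln_powR.
(* The exponent [1 - 2 * beta] is positive because [beta < 1 / 2]. *)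
- by near: n; apply: near_ge_ln_powR => //; lra.
- by near: n; exact: fA.
- by near: n; exact: fT.
(* Enough for [67 / alpha * expR (- x) <= eps], since [x <= expR x]. *)
have : 67 / alpha / eps <= ln n%:R `^ beta.
  by near: n; apply: near_ge_ln_powR => //; rewrite !divr_gt0.
move: (_ `^ _) => x hx; rewrite expRN ler_pdivrMr ?expR_gt0 //.
rewrite ler_pdivrMr // in hx; apply: le_trans hx _.
by rewrite mulrC ler_pM2l // (le_trans _ (expR_ge1Dx x)) // lerDr.
Unshelve. all: by end_near. Qed.
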